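(* Let $\mathcal C\subseteq\mathbb R^d$ be nonempty, compact and convex, and let $f\colon\mathbb R^d\to\mathbb R$ be convex, continuously differentiable and $L$-smooth on $\mathcal C$ for some $L>0$. Let $\mathcal M=\operatorname{argmin}_{x\in\mathcal C}f(x)$ and $f^\star=\min_{x\in\mathcal C}f(x)$. Suppose that $\mathcal C$, together with its fixed LMO selector $S$, satisfies local dual sharpness around $\mathcal M$ with constants $(A,q)$, where $A>0$ and $q\ge2$. Assume also that $f$ satisfies a local Hölder error bound of order $r\ge2$ around $\mathcal M$ with constants $(B,\rho)$, $B,\rho>0$. Let $(x_t)$ be the Frank--Wolfe iterates (from an arbitrary $x_0\in\mathcal C$) generated with any one of the following rules: the global short-step rule, exact line search, or the classical open-loop rule $\gamma_t=2/(t+2)$. Then there exist $t_0\in\mathbb N$ and $K>0$ such that $$f(x_t)-f^\star\le\frac{K}{(t-t_0+1)^{rq/(rq-2)}}\qquad\text{for all }t\ge t_0 .$$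
   Context: Norms are Euclidean. Coordinates are taken on the affine hull of $\mathcal C$; equivalently, the definitions are read relative to $\operatorname{aff}(\mathcal C)$, with directions and gradients projected to its linear span. $L$-smooth on $\mathcal C$: $f(y)\le f(x)+\langle\nabla f(x),y-x\rangle+\frac L2\|y-x\|^2$ for all $x,y\in\mathcal C$. LMO selector: a fixed deterministic map $S\colon\mathbb R^d\to\mathcal C$ with $S(g)\in\operatorname{argmin}_{s\in\mathcal C}\langle g,s\rangle$ for every $g$. Frank--Wolfe: given $x_0\in\mathcal C$, for $t=0,1,2,\dots$ set $s_t=S(\nabla f(x_t))$ and $x_{t+1}=x_t+\gamma_t(s_t-x_t)$ with $\gamma_t\in[0,1]$. Write $g_t=\langle\nabla f(x_t),x_t-s_t\rangle$ and $d_t=\|x_t-s_t\|$. Global short-step rule: $\gamma_t=\min\{g_t/(Ld_t^2),1\}$ (if $d_t=0$, then $x_{t+1}=x_t$ for any $\gamma_t\in[0,1]$). Exact line search: $\gamma_t\in\operatorname{argmin}_{\gamma\in[0,1]}f(x_t+\gamma(s_t-x_t))$. Classical open-loop rule: $\gamma_t=2/(t+2)$. Local dual sharpness (LDS): for nonempty $M\subseteq\mathcal C$, $A>0$ and real $q\ge2$, $\mathcal C$ together with the selector $S$ satisfies local dual sharpness around $M$ with constants $(A,q)$ if there is $\rho'>0$ such that for every $x\in\mathcal C$ with $\operatorname{dist}(x,M)<\rho'$ and every $g\in\mathbb R^d$, $$A\|g\|\,\|x-S(g)\|^q\le\langle g,x-S(g)\rangle .$$ Local Hölder error bound of order $r\ge2$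 ($r$ real) around $\mathcal M$ with constants $B,\rho>0$: $\operatorname{dist}(x,\mathcal M)^r\le B\,(f(x)-f^\star)$ for all $x\in\mathcal C$ with $\operatorname{dist}(x,\mathcal M)<\rho$. *)

(* Defs.v *)
From HB Require Import structures.
From mathcomp Require Import all_boot all_order all_algebra.
From mathcomp Require Import all_classical all_reals all_analysis.

Set Implicit Arguments.
Unset Strict Implicit.
Unset Printing Implicit Defensive.

Import Order.TTheory GRing.Theory Num.Theory.
Import numFieldNormedType.Exports.

Local Open Scope classical_set_scope.
Local Open Scope ring_scope.

(* The library norm on 'rV[R]_d is the sup norm, hence the explicit Euclidean
   inner product and norm; the two norms induce the same topology, so [compact],
   [differentiable] and [continuous] are the library's. *)
Definition dotv (R : realType) (d : nat) (u v : 'rV[R]_d) : R :=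
  \sum_(i < d) u 0 i * v 0 i.

Definition enorm (R : realType) (d : nat) (u : 'rV[R]_d) : R :=
  Num.sqrt (dotv u u).

Definition dist (R : realType) (d : nat) (x : 'rV[R]_d) (M : set 'rV[R]_d) : R :=
  inf [set enorm (x - y) | y in M].

Definition argmin (R : realType) (T : Type) (D : set T) (h : T -> R) : set T :=
  [set x | D x /\ forall y, D y -> h x <= h y].

Definition minval (R : realType) (T : Type) (D : set T) (h : T -> R) : R :=
  inf (h @` D).

Definition gradient (R : realType) (d : nat) (f : 'rV[R]_d -> R)
    (x : 'rV[R]_d) : 'rV[R]_d :=
  \row_(i < d) 'D_(delta_mx 0 i) f x.

Definition continuously_differentiable (R : realType) (d : nat)
    (f : 'rV[R]_d -> R) : Prop :=
  (forall x, differentiable f x) /\ continuous (gradient f).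

Definition smooth_on (R : realType) (d : nat) (C : set 'rV[R]_d) (L : R)
    (f : 'rV[R]_d -> R) : Prop :=
  forall x y, C x -> C y ->
    f y <= f x + dotv (gradient f x) (y - x) + L / 2 * enorm (y - x) ^+ 2.

(* Linear space parallel to aff(C), i.e. the linear span of C - C. *)
Definition direction_space (R : realType) (d : nat) (C : set 'rV[R]_d) :
    set 'rV[R]_d :=
  [set v | forall U : {vspace 'rV[R]_d},
             (forall x y, C x -> C y -> x - y \in U) -> v \in U].

(* Orthogonal projection of g onto [direction_space C]; the set below is
   always a singleton, so the default value of [xget] is never used. *)
Definition direction_proj (R : realType) (d : nat) (C : set 'rV[R]_d)
    (g : 'rV[R]_d) : 'rV[R]_d :=
  xget 0 [set p | direction_space C p /\
                  forall v, direction_space C v -> dotv (g - p) v = 0].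

Definition lmo_selector (R : realType) (d : nat) (C : set 'rV[R]_d)
    (S : 'rV[R]_d -> 'rV[R]_d) : Prop :=
  forall g, argmin C (dotv g) (S g).

(* Read relative to aff(C): the norm of g is that of its projection onto
   [direction_space C], which is g itself when aff(C) is the whole space.
   The right-hand side needs no projection, since x - S g lies in that span. *)
Definition local_dual_sharpness (R : realType) (d : nat) (C : set 'rV[R]_d)
    (S : 'rV[R]_d -> 'rV[R]_d) (M : set 'rV[R]_d) (A q : R) : Prop :=
  exists2 rho' : R, 0 < rho' &
    forall x, C x -> dist x M < rho' -> forall g,
      A * enorm (direction_proj C g) * enorm (x - S g) `^ q
        <= dotv g (x - S g).

Definition local_holder_error_bound (R : realType) (d : nat)
    (C : set 'rV[R]_d) (f : 'rV[R]_d -> R) (r B rho : R) : Prop :=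
  forall x, C x -> dist x (argmin C f) < rho ->
    dist x (argmin C f) `^ r <= B * (f x - minval C f).

Definition frank_wolfe (R : realType) (d : nat) (C : set 'rV[R]_d)
    (f : 'rV[R]_d -> R) (S : 'rV[R]_d -> 'rV[R]_d)
    (x : nat -> 'rV[R]_d) (gamma : nat -> R) : Prop :=
  C (x 0%N) /\
  forall t, 0 <= gamma t <= 1 /\
    x t.+1 = x t + gamma t *: (S (gradient f (x t)) - x t).

Definition fw_gap (R : realType) (d : nat) (f : 'rV[R]_d -> R)
    (S : 'rV[R]_d -> 'rV[R]_d) (x : 'rV[R]_d) : R :=
  dotv (gradient f x) (x - S (gradient f x)).

Definition fw_dist (R : realType) (d : nat) (f : 'rV[R]_d -> R)
    (S : 'rV[R]_d -> 'rV[R]_d) (x : 'rV[R]_d) : R :=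
  enorm (x - S (gradient f x)).

(* The step size is unconstrained (in [0, 1]) when d_t = 0. *)
Definition short_step (R : realType) (d : nat) (f : 'rV[R]_d -> R)
    (S : 'rV[R]_d -> 'rV[R]_d) (L : R)
    (x : nat -> 'rV[R]_d) (gamma : nat -> R) : Prop :=
  forall t, fw_dist f S (x t) != 0 ->
    gamma t = Num.min (fw_gap f S (x t) / (L * fw_dist f S (x t) ^+ 2)) 1.

Definition exact_line_search (R : realType) (d : nat) (f : 'rV[R]_d -> R)
    (S : 'rV[R]_d -> 'rV[R]_d)
    (x : nat -> 'rV[R]_d) (gamma : nat -> R) : Prop :=
  forall t, argmin `[0, 1]
    (fun c : R => f (x t + c *: (S (gradient f (x t)) - x t))) (gamma t).

Definition open_loop (R : realType) (gamma : nat -> R) : Prop :=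
  forall t, gamma t = 2 / (t%:R + 2).

(* Main.v *)
(* Smoothness makes both the short step and exact line search decrease f at
   least as much as the open-loop step c = 2 / (t + 2), so all three rules
   satisfy h' <= h - c g + (L / 2) c^2 d^2 for the primal error h, the gap
   g >= h and the distance d to the vertex, and h tends to 0; by compactness
   the iterates eventually stay in the neighbourhood of M where both local
   conditions hold.

   There convexity gives h <= p dist(x, M), with p the norm of the projected
   gradient, and combining it with the error bound and dual sharpness yields
   d^2 <= C g / h^(1/b), where b = rq / (rq - 2).  As long as h >= K0 (t + 2)^-b
   with K0 large, the quadratic term is then at most eps * c g, and h contracts
   by the factor 1 - c (1 - eps), which keeps h below a multiple of (t + 2)^-b if
   2 (1 - eps) >= b; when h is smaller, the increase c^2 d^2 <= c^2 diam^2 is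
   harmless because b <= 2.

   This leaves no room when b = 2, i.e. r = q = 2.  The gradient is constant on
   M.  If it vanishes along aff(C), a quadratic upper bound at the minimizer
   improves g >= h to g >= (1 + 1 / (4 L B)) h, which restores the slack.
   Otherwise p is bounded below near M, so d^2 <= C g and the contraction
   factor is 1 - 2 / n + O(1 / n^2) with n = t + 2. *)
Require Import Defs.
From HB Require Import structures.
From mathcomp Require Import all_boot all_order all_algebra.
From mathcomp Require Import all_classical all_reals all_analysis.
From mathcomp Require Import ring lra.

Set Implicit Arguments.
Unset Strict Implicit.
Unset Printing Implicit Defensive.

Import Order.TTheory GRing.Theory Num.Theory.
Import numFieldNormedType.Exports.

Local Open Scope classical_set_scope.
Local Open Scope ring_scope.

(** * Polynomial decay of real recursions *)

(** The power is exp(-b ln(1 + 1/N)); then exp y >= 1 + y and ln(1 + 1/N) <= 1/N give the bound. *)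
Lemma powR_succ_ratio_ge (R : realType) (N b : R) :
  0 < N -> 0 <= b -> 1 - b / N <= (N / (N + 1)) `^ b.
Proof.
move=> N0 b0; have N1 : 0 < N + 1 by lra.
have y0 : 0 < N / (N + 1) by rewrite divr_gt0.
rewrite /powR gt_eqF//; apply: le_trans (expR_ge1Dx _); rewrite lerD2l -mulrN.
apply: ler_wpM2l => //; rewrite -[N / _]invrK lnV ?posrE ?invr_gt0// lerN2.
have -> : (N / (N + 1))^-1 = 1 + N^-1 by field; lra.
by apply: le_ln1Dx; apply: lt_trans (_ : 0 < _); rewrite ?invr_gt0//; lra.
Qed.

(* The shift [m] of the barrier [K / (n + m) `^ b] absorbs the second-order
   term [c / n ^+ 2]. *)
Lemma powR_decay (R : realType) (h : nat -> R) (b c E K0 : R) (t1 : nat) :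
  1 <= b <= 2 -> 0 <= c -> 0 <= E -> 0 <= K0 -> (forall t, 0 <= h t) ->
  (forall t, (t1 <= t)%N -> h t.+1 <= h t + E / (t%:R + 2) ^+ 2) ->
  (forall t, (t1 <= t)%N -> K0 / (t%:R + 2) `^ b <= h t ->
    h t.+1 <= (1 - b / (t%:R + 2) + c / (t%:R + 2) ^+ 2) * h t) ->
  exists (t0 : nat) (K : R), 0 < K /\
    forall t, (t0 <= t)%N -> h t <= K / (t%:R + 2) `^ b.
Proof.
move=> /andP[b1 b2] c0 E0 K00 h0 hE hc.
(* Starting at [t2] ensures m <= t, hence N <= 2n below. The last two summands of [K] serve the base
   case and the case of small [h]. *)
pose m := 2 * c; pose t2 := maxn t1 (Num.trunc m).+1.
pose K := 1 + h t2 * (t2%:R + 2 + m) `^ b + (K0 + E) * (m + 2) `^ b.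
have m0 : 0 <= m by rewrite /m; lra.
have m2 : 0 < m + 2 by lra.
have K_gt0 : 0 < K.
  by rewrite /K -addrA ltr_pwDl// addr_ge0// mulr_ge0 ?powR_ge0 ?addr_ge0.
have n_gt0 t : 0 < t%:R + 2 :> R by rewrite ltr_wpDl.
have N_gt0 t : 0 < t%:R + 2 + m :> R by rewrite ltr_pwDl.
have barrier t : (t2 <= t)%N -> h t <= K / (t%:R + 2 + m) `^ b.
  move/subnKC <-; elim: (t - t2)%N => [|k IH].
    rewrite addn0 ler_pdivlMr ?powR_gt0// /K.
    have : 0 <= (K0 + E) * (m + 2) `^ b by rewrite mulr_ge0 ?powR_ge0 ?addr_ge0.
    lra.
  rewrite addnS; set s := (t2 + k)%N in IH *.
  have t2s : (t2 <= s)%N by rewrite leq_addr.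
  have t1s : (t1 <= s)%N by apply: leq_trans t2s; rewrite leq_maxl.
  have ms : m <= s%:R.
    rewrite (le_trans (ltW (truncnS_gt m)))// ler_nat.
    by apply: leq_trans t2s; rewrite leq_maxr.
  have -> : s.+1%:R + 2 + m = s%:R + 2 + m + 1 :> R by rewrite -natr1; ring.
  move: (N_gt0 s) (n_gt0 s); set n := s%:R + 2; set N := n + m => N0 n0.
  have [big|small] := leP (K0 / n `^ b) (h s).
    apply: (le_trans (hc _ t1s big)); rewrite -/n.
    (* It suffices that the contraction factor is at most 1 - b/N, a lower bound for the ratio of
       consecutive barrier values. *)
    have -> : K / (N + 1) `^ b = (N / (N + 1)) `^ b * (K / N `^ b).
      have -> : N `^ b = (N / (N + 1)) `^ b * (N + 1) `^ b.
        by rewrite -powRM ?divr_ge0 ?divfK//; lra.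
      have q0 : 0 < (N / (N + 1)) `^ b by rewrite powR_gt0// divr_gt0//; lra.
      have p0 : 0 < (N + 1) `^ b by rewrite powR_gt0//; lra.
      by field; rewrite !gt_eqF.
    apply: le_trans (_ : (N / (N + 1)) `^ b * h s <= _); last first.
      by rewrite ler_wpM2l ?powR_ge0.
    apply: ler_wpM2r => //; apply: le_trans (powR_succ_ratio_ge N0 _); last lra.
    (* The shift gains b m / (n N), which beats c / n^2 because m = 2c, N <= 2n and b >= 1. *)
    suff : 0 <= b / n - b / N - c / n ^+ 2 by lra.
    have -> : b / n - b / N - c / n ^+ 2 = (b * m * n - c * N) / (n ^+ 2 * N).
      by rewrite /N; field; rewrite !gt_eqF.
    apply: divr_ge0; last by rewrite mulr_ge0 ?exprn_ge0 ?ltW.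
    rewrite subr_ge0.
    apply: le_trans (_ : c * (2 * n) <= _); first by apply: ler_wpM2l; rewrite /N /n; lra.
    have : 0 <= c * n * (b - 1) by apply: mulr_ge0; [exact: mulr_ge0 c0 (ltW n0)|lra].
    by rewrite /m; lra.
  apply: (le_trans (hE _ t1s)); rewrite -/n.
  (* Since n >= 1 and b <= 2, the increment E / n^2 is at most E / n^b; passing from n to N + 1 <=
     (m + 2) n costs the factor (m + 2)^b present in [K]. *)
  have n1 : 1 <= n by rewrite /n ler_wpDl// ler1n.
  have nb : n `^ b <= n ^+ 2 by rewrite -(powR_mulrn 2 (ltW n0)); exact: ler_powR.
  apply: le_trans (_ : (K0 + E) / n `^ b <= _).
    rewrite mulrDl lerD ?(ltW small)// ler_wpM2l// lef_pV2 ?posrE ?powR_gt0//.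
    exact: exprn_gt0.
  have Np : 0 < (N + 1) `^ b by rewrite powR_gt0//; lra.
  rewrite ler_pdivlMr// mulrAC ler_pdivrMr ?powR_gt0//.
  apply: le_trans (_ : (K0 + E) * ((m + 2) * n) `^ b <= _).
    rewrite ler_wpM2l ?addr_ge0//; apply: ge0_ler_powR; rewrite ?nnegrE.
    - lra.
    - by rewrite /N addr_ge0 ?ltW// /N.
    - by rewrite mulr_ge0 ?ltW.
    - by rewrite /N; nra.
  rewrite (powRM _ (ltW m2) (ltW n0)) mulrA ler_wpM2r ?powR_ge0// /K lerDr addr_ge0//.
  by rewrite mulr_ge0 ?powR_ge0.
exists t2, K; split=> // t t2t; apply: (le_trans (barrier t t2t)).
rewrite ler_wpM2l ?(ltW K_gt0)// lef_pV2 ?posrE ?powR_gt0//.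
by apply: ge0_ler_powR; rewrite ?nnegrE; [lra|exact: ltW|exact: ltW|lra].
Qed.

(** * Euclidean inner product, orthogonal projection and distance to a set *)

Section euclidean.
Context {R : realType} {d : nat}.
Implicit Types u v w : 'rV[R]_d.

Lemma dotvC u v : dotv u v = dotv v u.
Proof. by apply: eq_bigr => i _; rewrite mulrC. Qed.

Lemma dotvDr u v w : dotv u (v + w) = dotv u v + dotv u w.
Proof. by rewrite /dotv -big_split/=; apply: eq_bigr => i _; rewrite mxE mulrDr. Qed.

Lemma dotvZr u k v : dotv u (k *: v) = k * dotv u v.
Proof. by rewrite /dotv mulr_sumr; apply: eq_bigr => i _; rewrite mxE; ring. Qed.

Lemma dotvNr u v : dotv u (- v) = - dotv u v.
Proof. by rewrite -scaleN1r dotvZr mulN1r. Qed.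

Lemma dotvBr u v w : dotv u (v - w) = dotv u v - dotv u w.
Proof. by rewrite dotvDr dotvNr. Qed.

Lemma dotvBl u v w : dotv (u - v) w = dotv u w - dotv v w.
Proof. by rewrite ![dotv _ w]dotvC dotvBr. Qed.

Lemma dotvZl k u v : dotv (k *: u) v = k * dotv u v.
Proof. by rewrite ![dotv _ v]dotvC dotvZr. Qed.

Lemma dotv0r u : dotv u 0 = 0.
Proof. by rewrite -(scale0r 0) dotvZr mul0r. Qed.

Lemma dotvv_ge0 u : 0 <= dotv u u.
Proof. by apply: sumr_ge0 => i _; rewrite -expr2 sqr_ge0. Qed.

Lemma dotvv_eq0 u : (dotv u u == 0) = (u == 0).
Proof.
apply/idP/eqP => [|->]; last by rewrite dotv0r.
rewrite psumr_eq0 => [/allP/= u0|i _]; last by rewrite -expr2 sqr_ge0.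
apply/rowP => i; rewrite mxE; apply/eqP.
by have := u0 i (mem_index_enum _); rewrite -expr2 sqrf_eq0.
Qed.

Lemma enorm_ge0 u : 0 <= enorm u. Proof. exact: sqrtr_ge0. Qed.

Lemma sqr_enorm u : enorm u ^+ 2 = dotv u u.
Proof. by rewrite sqr_sqrtr// dotvv_ge0. Qed.

Lemma enorm_eq0 u : (enorm u == 0) = (u == 0).
Proof. by rewrite -sqrf_eq0 sqr_enorm dotvv_eq0. Qed.

Lemma enorm0 : enorm (0 : 'rV[R]_d) = 0.
Proof. by apply/eqP; rewrite enorm_eq0. Qed.

Lemma enormZ k u : enorm (k *: u) = `|k| * enorm u.
Proof. by rewrite /enorm dotvZl dotvZr mulrA -expr2 sqrtrM ?sqr_ge0// sqrtr_sqr. Qed.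

Lemma enormB u v : enorm (u - v) = enorm (v - u).
Proof. by rewrite -opprB -scaleN1r enormZ normrN1 mul1r. Qed.

(** Cauchy-Schwarz, read off from the nonnegative squared norm of
    [dotv v v *: u - dotv u v *: v]. *)
Lemma dotv_le_enorm u v : dotv u v <= enorm u * enorm v.
Proof.
have [->|v0] := eqVneq v 0; first by rewrite dotv0r enorm0 mulr0.
have vv : 0 < dotv v v by rewrite lt_neqAle eq_sym dotvv_eq0 v0 dotvv_ge0.
have uv : dotv u v ^+ 2 <= (enorm u * enorm v) ^+ 2.
  rewrite exprMn !sqr_enorm -(ler_pM2l vv) -subr_ge0.
  have := dotvv_ge0 (dotv v v *: u - dotv u v *: v).
  rewrite dotvBr !dotvZr !dotvBl !dotvZl (dotvC v u).
  by congr (0 <= _); ring.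
apply: le_trans (ler_norm _) _.
by rewrite -ler_sqr ?nnegrE ?mulr_ge0 ?enorm_ge0// real_normK ?num_real.
Qed.

Lemma enorm_triangle u v : enorm (u + v) <= enorm u + enorm v.
Proof.
rewrite -ler_sqr ?nnegrE ?addr_ge0 ?enorm_ge0// sqrrD !sqr_enorm.
rewrite dotvDr ![dotv (u + v) _]dotvC !dotvDr (dotvC v u).
have := dotv_le_enorm u v; lra.
Qed.

Lemma dotv_continuous (T : topologicalType) (F G : T -> 'rV[R]_d) :
  continuous F -> continuous G -> continuous (fun x => dotv (F x) (G x)).
Proof.
move=> cF cG; apply: (continuous_big (op := +%R)) => [|i _ x].
  exact: add_continuous.
apply: cvgM.
  exact: (continuous_comp (cF x) (@coord_continuous R 1 d 0 i (F x))).
exact: (continuous_comp (cG x) (@coord_continuous R 1 d 0 i (G x))).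
Qed.

Lemma enorm_continuous : continuous (@enorm R d).
Proof.
move=> x; apply: (continuous_comp (f := fun x => dotv x x)).
  by apply: dotv_continuous => ?; exact: cvg_id.
exact: sqrt_continuous.
Qed.

(** Gram-Schmidt: the new generator [a] is made orthogonal to the old span by subtracting its
    projection [b], and the component of g - p along e = a - b is added to the old projection [p].
    If e = 0, nothing is added. *)
Lemma orthogonal_projection_span (X : seq 'rV[R]_d) g :
  exists2 p, p \in <<X>>%VS & forall v, v \in <<X>>%VS -> dotv (g - p) v = 0.
Proof.
elim: X g => [|a X IH] g.
  exists 0 => [|v]; first exact: mem0v.
  by rewrite span_nil memv0 => /eqP ->; rewrite dotv0r.
have [p pX gp] := IH g; have [b bX ab] := IH a.
have bX' : {subset <<X>>%VS <= <<a :: X>>%VS}.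
  by apply/subvP; rewrite span_cons addvSr.
have aX : a \in <<a :: X>>%VS by rewrite memv_span// mem_head.
set e := a - b; have eX : e \in <<a :: X>>%VS by rewrite memvB// bX'.
pose k := dotv (g - p) e / dotv e e.
exists (p + k *: e) => [|v]; first by rewrite memvD ?memvZ// bX'.
rewrite span_cons => /memv_addP[_ /vlineP[l ->] [w wX ->]].
have -> : l *: a + w = l *: e + (l *: b + w).
  by rewrite addrA -scalerDr subrK.
have wX' : l *: b + w \in <<X>>%VS by rewrite memvD// memvZ.
rewrite opprD addrA dotvBl (dotvDr (g - p)) (dotvDr (k *: e)) !(dotvZl k).
rewrite (gp _ wX') (ab _ wX' : dotv e _ = 0) !addr0 mulr0 addr0 !dotvZr.
have [e0|e0] := eqVneq (dotv e e) 0; last by rewrite /k; field.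
by move/eqP: e0; rewrite dotvv_eq0 => /eqP ->; rewrite !dotv0r; ring.
Qed.

(** A subspace of least dimension containing all differences works: its intersection with any other
    such subspace still contains them, so by minimality it is the whole of it. *)
Lemma direction_space_vspace (C : set 'rV[R]_d) :
  exists U : {vspace 'rV[R]_d}, forall v, direction_space C v <-> v \in U.
Proof.
pose P n := `[<exists2 U : {vspace 'rV[R]_d},
  \dim U = n & forall x y, C x -> C y -> x - y \in U>].
have exP : exists n, P n.
  exists (\dim (fullv : {vspace 'rV[R]_d})); apply/asboolP.
  by exists fullv => // *; rewrite memvf.
have [n /asboolP[U Un CU] nmin] := ex_minnP exP.
exists U => v; split=> [|vU V CV]; first exact.
have : (U :&: V)%VS == U.
  rewrite eqEdim capvSl/= Un; apply: nmin; apply/asboolP; exists (U :&: V)%VS => //.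
  by move=> x y Cx Cy; rewrite memv_cap CU// CV.
by move=> /eqP UV; move: vU; rewrite -UV memv_cap => /andP[].
Qed.

(** Existence of the projection makes [xget] return a genuine one. This lets Cauchy-Schwarz along
    feasible directions involve only the projected gradient, the quantity in the sharpness
    condition. *)
Lemma dotv_direction_proj (C : set 'rV[R]_d) g x y : C x -> C y ->
  dotv (direction_proj C g) (x - y) = dotv g (x - y).
Proof.
move=> Cx Cy; have [U CU] := direction_space_vspace C.
have [p pU gp] := orthogonal_projection_span (vbasis U) g.
have U_span : <<vbasis U>>%VS = U by exact: span_basis (vbasisP U).
have : exists p, direction_space C p /\
    forall v, direction_space C v -> dotv (g - p) v = 0.
  exists p; split; first by apply/CU; rewrite -U_span.
  by move=> v /CU; rewrite -U_span; exact: gp.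
move=> /(@xgetPex _ 0)/=[_ orth]; apply/esym/eqP.
by rewrite -subr_eq0 -dotvBl; apply/eqP/orth => V; exact.
Qed.

Lemma dist_le (M : set 'rV[R]_d) x y : M y -> dist x M <= enorm (x - y).
Proof.
move=> My; apply: ge_inf; last by exists y.
by exists 0 => _ [z _ <-]; exact: enorm_ge0.
Qed.

Lemma dist_ge (M : set 'rV[R]_d) x e : M !=set0 ->
  (forall y, M y -> e <= enorm (x - y)) -> e <= dist x M.
Proof.
move=> [z Mz] eM; apply: lb_le_inf; first by exists (enorm (x - z)), z.
by move=> _ [y My <-]; exact: eM.
Qed.

Lemma dist_lt (M : set 'rV[R]_d) x e : M !=set0 -> dist x M < e ->
  exists2 y, M y & enorm (x - y) < e.
Proof.
move=> M0 xe; apply: contrapT => nex.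
suff : e <= dist x M by rewrite leNgt xe.
by apply: dist_ge => // y My; rewrite leNgt; apply/negP => ?; apply: nex; exists y.
Qed.

Lemma dist_continuous (M : set 'rV[R]_d) : M !=set0 -> continuous (fun x : 'rV[R]_d => dist x M).
Proof.
move=> M0 x; have dist_lip y z : dist y M <= dist z M + enorm (y - z).
  rewrite -lerBlDr; apply: dist_ge => // w Mw; rewrite lerBlDr.
  apply: (le_trans (dist_le y Mw)); have := enorm_triangle (y - z) (z - w).
  by rewrite addrA subrK (addrC (enorm _)).
apply/(@cvgrPdist_le _ _ _ (nbhs x)) => e e0.
have : enorm (x - y) @[y --> x] --> enorm (x - x).
  have cB : continuous_at x (fun y => x - y).
    by apply: continuousB; [exact: cst_continuous|exact: cvg_id].
  exact: (continuous_comp cB (@enorm_continuous (x - x))).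
rewrite subrr enorm0 => /cvgrPdist_le/(_ e e0); apply: filterS => y.
rewrite sub0r normrN ger0_norm ?enorm_ge0// => xy.
rewrite ler_norml; have := dist_lip x y; have := dist_lip y x.
rewrite (enormB y); lra.
Qed.

End euclidean.

(** * First-order properties of convex functions, and localization by compactness *)

Section convex_gradient.
Context {R : realType} {d : nat}.
Implicit Types (C : set 'rV[R]_d) (f : 'rV[R]_d -> R).

Lemma convex_set_segment C x y (c : R) : convex_set C -> C x -> C y ->
  0 <= c <= 1 -> C (x + c *: (y - x)).
Proof.
move=> cC Cx Cy /andP[c0 c1].
have := cC y x (Itv01 c0 c1) (mem_set Cy) (mem_set Cx); rewrite inE.
by congr (C _); rewrite /conv/= /unstable.onem scalerBl scale1r scalerBr addrCA addrA addrAC.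
Qed.

Lemma convex_function_segment f x y (c : R) :
  convex_function (setT : set 'rV[R]_d) f -> 0 <= c <= 1 ->
  f (x + c *: (y - x)) <= f x + c * (f y - f x).
Proof.
move=> cf /andP[c0 c1].
have := cf (Itv01 c0 c1) y x (mem_set I) (mem_set I).
rewrite [X in f X](_ : _ = x + c *: (y - x)); last first.
  by rewrite /conv/= /unstable.onem scalerBl scale1r scalerBr addrCA addrA addrAC.
by rewrite convRE/= /unstable.onem => /le_trans; apply; lra.
Qed.

Lemma dotv_gradient f x v : differentiable f x ->
  dotv (gradient f x) v = 'D_v f x.
Proof.
move=> df; rewrite deriveE// [in RHS](row_sum_delta v) linear_sum/=.
by apply: eq_bigr => i _; rewrite linearZ/= mxE deriveE// mulrC.
Qed.

Lemma derive_le_right f x v k : differentiable f x ->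
  (forall c : R, 0 < c <= 1 -> f (x + c *: v) <= f x + c * k) ->
  'D_v f x <= k.
Proof.
move=> df fk; have dfv := @diff_derivable _ _ _ _ _ v df.
apply: (cvgr_to_le (cvg_dnbhs_at_right dfv)).
near=> c; have c0 : 0 < c by near: c; exact: nbhs_right_gt.
have c1 : c <= 1 by near: c; exact: nbhs_right_le.
rewrite /= /shift/= (addrC (c *: v)) /GRing.scale/= ler_pdivrMl// lerBlDl.
by apply: fk; rewrite c0.
Unshelve. all: by end_near. Qed.

Lemma derive_ge_right f x v k : differentiable f x ->
  (forall c : R, 0 < c <= 1 -> f x + c * k <= f (x + c *: v)) ->
  k <= 'D_v f x.
Proof.
move=> df fk; rewrite -lerN2 -deriveN; last exact: diff_derivable.
apply: derive_le_right => [|c c01]; first exact: differentiableN.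
by have := fk c c01; rewrite !opprfctE; lra.
Qed.

Lemma convex_gradient_le f x y :
  convex_function (setT : set 'rV[R]_d) f -> differentiable f x ->
  f x + dotv (gradient f x) (y - x) <= f y.
Proof.
move=> cf df; rewrite -lerBrDl dotv_gradient//; apply: derive_le_right => // c.
by move=> /andP[/ltW c0 c1]; apply: convex_function_segment; rewrite ?c0.
Qed.

Lemma argmin_gradient_ge0 C f y z : convex_set C -> differentiable f y ->
  argmin C f y -> C z -> 0 <= dotv (gradient f y) (z - y).
Proof.
move=> cC df [Cy fmin] Cz; rewrite dotv_gradient//.
apply: derive_ge_right => // c /andP[/ltW c0 c1]; rewrite mulr0 addr0.
by apply: fmin; apply: convex_set_segment; rewrite ?c0.
Qed.

(** The tangent of [f] at [y], evaluated at z + c w, and optimality of [y] give f z + c <grad f y,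
    w> <= f(z + c w), so <grad f y, w> <= <grad f z, w>. With [w] the difference of the gradients
    this says |w|^2 <= 0. The point z + c w may leave [C], so convexity is used on the whole
    space. *)
Lemma argmin_gradient_eq C f y z : convex_set C ->
  convex_function (setT : set 'rV[R]_d) f -> (forall x, differentiable f x) ->
  argmin C f y -> argmin C f z -> gradient f y = gradient f z.
Proof.
move=> cC cf df My Mz; have [Cy ymin] := My; have [Cz zmin] := Mz.
have fyz : f y = f z by apply/eqP; rewrite eq_le ymin// zmin.
set w := gradient f y - gradient f z.
have : dotv w w <= 0.
  rewrite dotvBl subr_le0 [leRHS]dotv_gradient//.
  apply: derive_ge_right => // c _.
  have := convex_gradient_le (z + c *: w) cf (df y).
  rewrite addrAC dotvDr dotvZr.
  have := argmin_gradient_ge0 cC (df y) My Cz; lra.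
by rewrite le_eqVlt ltNge dotvv_ge0 orbF dotvv_eq0 subr_eq0 => /eqP.
Qed.

Lemma minvalE C f y : argmin C f y -> minval C f = f y.
Proof.
move=> [Cy ymin]; apply/eqP; rewrite eq_le; apply/andP; split.
  by apply: ge_inf; [exists (f y) => _ [z Cz <-]; exact: ymin|exists y].
by apply: lb_le_inf; [exists (f y), y|move=> _ [z Cz <-]; exact: ymin].
Qed.

(** The maximum of [h] and [u] is continuous and positive on [C]; its minimum over [C] serves as
    [e]. *)
Lemma compact_localize (C : set 'rV[R]_d) (h u : 'rV[R]_d -> R) :
  C !=set0 -> compact C -> continuous h -> continuous u ->
  (forall x, C x -> 0 <= h x) -> (forall x, C x -> h x = 0 -> 0 < u x) ->
  exists2 e, 0 < e & forall x, C x -> h x < e -> e <= u x.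
Proof.
move=> C0 cC ch cu h0 hu.
have [|z Cz zmin] := @EVT_min_rV _ _ (fun x => Num.max (h x) (u x)) _ C0 cC.
  apply: continuous_subspaceT => x.
  exact: (@continuous_max _ _ _ _ _ (ch x) (cu x)).
rewrite inE in Cz; exists (Num.max (h z) (u z)) => [|x Cx hx].
  rewrite lt_max; have := h0 _ Cz; rewrite le_eqVlt => /orP[/eqP hz|->//].
  by rewrite hu ?orbT.
by have := zmin x (mem_set Cx); rewrite le_max => /orP[|//]; rewrite leNgt hx.
Qed.

End convex_gradient.

(** * Scalar recursions for the primal error *)

Section descent.
Context {R : realType}.

(** Here [u] is the distance to the vertex, [tau] the distance to the minimizers and [p] the
    projected gradient norm. Multiplying sharpness by [tau] eliminates [p]: A h u^q <= A p tau u^q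
    <= g (B h)^(1/r). The claim follows on raising to the power 2/q. *)
Lemma sqr_dist_le_gap (h g u tau p A B q r : R) :
  0 < A -> 0 < B -> 2 <= q -> 2 <= r -> 0 < h -> h <= g ->
  0 <= u -> 0 <= tau -> 0 <= p -> h <= p * tau -> tau `^ r <= B * h ->
  A * p * u `^ q <= g ->
  u ^+ 2 <= (B `^ r^-1 / A) `^ (2 / q) * g / h `^ (1 - 2 / (r * q)).
Proof.
move=> A0 B0 q2 r2 h0 hg u0 tau0 p0 hp taur sharp.
have q0 : 0 < q by lra.
have r0 : 0 < r by lra.
have g0 : 0 < g by lra.
have tauB : tau <= B `^ r^-1 * h `^ r^-1.
  have -> : tau = (tau `^ r) `^ r^-1 by rewrite -powRrM mulfV ?gt_eqF// powRr1.
  rewrite -(powRM _ (ltW B0) (ltW h0)).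
  apply: ge0_ler_powR => //; rewrite ?nnegrE ?powR_ge0 ?invr_ge0 ?ltW//.
  by rewrite mulr_gt0.
have uq : u `^ q <= B `^ r^-1 / A * g * h `^ (r^-1 - 1).
  rewrite powRB; last by rewrite (gt_eqF h0) implybT.
  rewrite (powRr1 (ltW h0)).
  have -> : B `^ r^-1 / A * g * (h `^ r^-1 / h) =
    g * (B `^ r^-1 * h `^ r^-1) / (A * h) by field; rewrite !gt_eqF.
  rewrite ler_pdivlMr; last exact: mulr_gt0.
  apply: le_trans (_ : A * p * u `^ q * tau <= _).
    rewrite (_ : A * p * u `^ q * tau = u `^ q * (A * (p * tau))); last ring.
    by rewrite ler_wpM2l ?powR_ge0// ler_wpM2l// ltW.
  have Ap0 : 0 <= A * p * u `^ q by rewrite mulr_ge0 ?powR_ge0// mulr_ge0// ltW.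
  exact: ler_pM Ap0 tau0 sharp tauB.
have -> : u ^+ 2 = (u `^ q) `^ (2 / q).
  by rewrite -powRrM mulrC divfK ?gt_eqF// (powR_mulrn 2 u0).
apply: (@le_trans _ _ ((B `^ r^-1 / A * g * h `^ (r^-1 - 1)) `^ (2 / q))).
  apply: ge0_ler_powR => //; rewrite ?nnegrE ?powR_ge0 ?divr_ge0 ?ltW//.
  by rewrite !mulr_gt0 ?invr_gt0 ?powR_gt0.
have BA0 : 0 < B `^ r^-1 / A by rewrite divr_gt0 ?powR_gt0.
rewrite (powRM _ (ltW (mulr_gt0 BA0 g0)) (powR_ge0 _ _)).
rewrite (powRM _ (ltW BA0) (ltW g0)).
rewrite -!mulrA ler_wpM2l ?powR_ge0// -powRrM -powRN.
(* The exponent 2/q - 1 is nonpositive, so h <= g allows replacing g^(2/q - 1) by h^(2/q - 1). *)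
have -> : g `^ (2 / q) = g * g `^ (2 / q - 1).
  by rewrite mulr_powRB1 ?ltW// divr_gt0.
rewrite -mulrA ler_wpM2l ?(ltW g0)//.
have -> : - (1 - 2 / (r * q)) = (2 / q - 1) + (r^-1 - 1) * (2 / q).
  by field; rewrite !gt_eqF.
rewrite (@powRD _ h); last by rewrite (gt_eqF h0) implybT.
rewrite ler_wpM2r ?powR_ge0//.
rewrite -[2 / q - 1]opprB !powRN lef_pV2 ?posrE ?powR_gt0//.
apply: ge0_ler_powR; rewrite ?nnegrE ?(ltW h0) ?(ltW g0)// subr_ge0.
by rewrite ler_pdivrMr// mul1r.
Qed.

(** [D] stands for the squared distance to the vertex, and [descent] is the smoothness bound at the
    open-loop step. *)
Variables (h g D : nat -> R) (L E : R).
Hypotheses (L_gt0 : 0 < L) (h_ge0 : forall t, 0 <= h t)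
  (h_le_g : forall t, h t <= g t) (D_le : forall t, D t <= E)
  (descent : forall t,
    h t.+1 <= h t - 2 / (t%:R + 2) * g t + L / 2 * (2 / (t%:R + 2)) ^+ 2 * D t).

Let n_gt0 t : 0 < t%:R + 2 :> R. Proof. by rewrite ltr_wpDl. Qed.

Let descentE t :
  h t.+1 <= h t - 2 / (t%:R + 2) * g t + 2 * L * D t / (t%:R + 2) ^+ 2.
Proof.
apply: (le_trans (descent t)); rewrite lerD2l.
by rewrite le_eqVlt; apply/orP; left; apply/eqP; field; rewrite gt_eqF.
Qed.

(** The classical O(1/t) bound by induction. At t = 0 the factor t / (t + 2) vanishes, so the
    initial error does not enter. *)
Lemma descent_cvg0 (e : R) : 0 < e -> 0 <= E ->
  exists t1, forall t, (t1 <= t)%N -> h t < e.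
Proof.
move=> e0 E0; pose F := 2 * L * E.
have F0 : 0 <= F by rewrite /F !mulr_ge0// ltW.
have step t : h t.+1 <= t%:R / (t%:R + 2) * h t + F / (t%:R + 2) ^+ 2.
  apply: (le_trans (descentE t)); move: (n_gt0 t) => n0.
  apply: lerD.
    have -> : t%:R / (t%:R + 2) * h t = h t - 2 / (t%:R + 2) * h t.
      by field; rewrite gt_eqF.
    by rewrite lerD2l lerN2 ler_wpM2l// divr_ge0// ltW.
  rewrite ler_wpM2r ?invr_ge0 ?exprn_ge0 ?(ltW n0)// /F.
  by rewrite ler_wpM2l// mulr_ge0 ?ltW.
have bound t : h t.+1 <= F / (t%:R + 2).
  elim: t => [|t IH]; apply: (le_trans (step _)).
    rewrite mulr0n !add0r !mul0r add0r.
    rewrite -subr_ge0 (_ : _ - _ = F / 4) ?divr_ge0//; by field.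
  have -> : t.+1%:R = t%:R + 1 :> R by rewrite natr1.
  move: (ler0n R t) IH; set m : R := t%:R => m0 IH.
  apply: (@le_trans _ _ ((m + 1) / (m + 1 + 2) * (F / (m + 2)) + F / (m + 1 + 2) ^+ 2)).
    by rewrite lerD2r ler_wpM2l// divr_ge0; lra.
  rewrite -subr_ge0.
  have -> : F / (m + 1 + 2) - ((m + 1) / (m + 1 + 2) * (F / (m + 2)) +
     F / (m + 1 + 2) ^+ 2) = F / ((m + 2) * (m + 3) ^+ 2) by field; rewrite !gt_eqF; lra.
  by rewrite divr_ge0// mulr_ge0 ?exprn_ge0//; lra.
exists (Num.trunc (F / e)).+1 => -[//|t] Ft.
apply: (le_lt_trans (bound t)); rewrite ltr_pdivrMr// mulrC -ltr_pdivrMr//.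
apply: (lt_le_trans (truncnS_gt _)).
by apply: (@le_trans _ _ t.+1%:R); rewrite ?ler_nat// -natr1; lra.
Qed.

Lemma descent_powR_rate (b C1 kappa : R) (t1 : nat) :
  1 <= b <= 2 -> b < 2 * kappa -> 0 < C1 -> 0 <= E ->
  (forall t, (t1 <= t)%N -> 0 < h t ->
    kappa * h t <= g t /\ D t <= C1 * g t / h t `^ b^-1) ->
  exists (t0 : nat) (K : R), 0 < K /\
    forall t, (t0 <= t)%N -> h t <= K / (t%:R + 2) `^ b.
Proof.
move=> b12 bk C10 E0 near; have /andP[b1 b2] := b12.
have k0 : 0 < kappa by lra.
have b0 : 0 < b by lra.
(* This makes (2/n)(1 - eps) equal to b / (n kappa), so that g >= kappa h yields the contraction 1 -
   b/n. [K0] is chosen so that h >= K0 / n^b forces L D <= eps n g. *)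
pose eps := 1 - b / (2 * kappa).
have eps0 : 0 < eps by rewrite subr_gt0 ltr_pdivrMr ?mul1r// mulr_gt0.
pose K0 := (L * C1 / eps) `^ b.
have K00 : 0 < K0 by rewrite powR_gt0// divr_gt0// mulr_gt0.
apply: (@powR_decay _ _ b 0 (2 * L * E) K0 t1) => //.
- by rewrite !mulr_ge0// ltW.
- exact: ltW.
- move=> t _; apply: (le_trans (descentE t)); move: (n_gt0 t) => n0.
  apply: lerD.
    by rewrite gerBl mulr_ge0 ?divr_ge0 ?(ltW n0)// (le_trans (h_ge0 t)).
  rewrite ler_wpM2r ?invr_ge0 ?exprn_ge0 ?(ltW n0)//.
  by rewrite ler_wpM2l// mulr_ge0 ?ltW.
move=> t t1t Kh; move: (n_gt0 t) (descentE t) Kh.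
set n := t%:R + 2 => n0 hS Kh; rewrite mul0r addr0.
have h0 : 0 < h t by apply: lt_le_trans Kh; rewrite divr_gt0// powR_gt0.
have [kh DC] := near t t1t h0.
have g0 : 0 <= g t by rewrite (le_trans (h_ge0 t)).
have hb : L * C1 / eps / n <= h t `^ b^-1.
  have X0 : 0 < L * C1 / eps / n by rewrite !divr_gt0 ?mulr_gt0.
  have XE : K0 / n `^ b = (L * C1 / eps / n) `^ b.
    apply: (canLR (mulfK _)); first by rewrite gt_eqF ?powR_gt0.
    by rewrite -powRM ?(ltW X0) ?(ltW n0)// divfK// gt_eqF.
  rewrite XE in Kh.
  rewrite -[leLHS](powRr1 (ltW X0)) -(mulfV (lt0r_neq0 b0)) powRrM.
  by apply: ge0_ler_powR => //; rewrite ?nnegrE ?powR_ge0 ?invr_ge0 ?ltW.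
have LD : L * D t <= eps * n * g t.
  apply: (@le_trans _ _ (L * (C1 * g t / (L * C1 / eps / n)))).
    rewrite ler_wpM2l ?(ltW L_gt0)//; apply: (le_trans DC).
    rewrite ler_wpM2l ?mulr_ge0 ?(ltW C10)// lef_pV2// posrE ?powR_gt0//.
    by rewrite !divr_gt0 ?mulr_gt0.
  by rewrite le_eqVlt; apply/orP; left; apply/eqP; field; rewrite !gt_eqF.
apply: (le_trans hS).
have -> : (1 - b / n) * h t = h t - b / (n * kappa) * (kappa * h t).
  by field; rewrite !gt_eqF.
apply: (@le_trans _ _ (h t - b / (n * kappa) * g t)); last first.
  by rewrite lerD2l lerN2 ler_wpM2l// divr_ge0 ?mulr_ge0 ?ltW.
rewrite -addrA lerD2l.
apply: (@le_trans _ _ (- (2 / n * g t) + 2 * (eps * n * g t) / n ^+ 2)).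
  rewrite lerD2l ler_wpM2r ?invr_ge0 ?exprn_ge0 ?(ltW n0)//.
  by rewrite -mulrA ler_wpM2l.
by rewrite le_eqVlt; apply/orP; left; apply/eqP; rewrite /eps; field; rewrite !gt_eqF.
Qed.

(** Both correction terms are now multiples of [g]. Once n >= L C1 their total coefficient is
    nonpositive, and [g] may be replaced by [h]. The contraction holds for every size of [h], hence
    the threshold 0 passed to [powR_decay]. *)
Lemma descent_sqr_rate (C1 : R) (t1 : nat) :
  0 <= C1 -> 0 <= E -> (forall t, (t1 <= t)%N -> D t <= C1 * g t) ->
  exists (t0 : nat) (K : R), 0 < K /\
    forall t, (t0 <= t)%N -> h t <= K / (t%:R + 2) `^ 2.
Proof.
move=> C10 E0 near.
have LC0 : 0 <= L * C1 by rewrite mulr_ge0// ltW.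
apply: (@powR_decay _ _ 2 (2 * L * C1) (2 * L * E) 0
  (maxn t1 (Num.trunc (L * C1)).+1)) => //.
- by rewrite lexx andbT ler1n.
- by rewrite -mulrA mulr_ge0.
- by rewrite !mulr_ge0// ltW.
- move=> t _; apply: (le_trans (descentE t)); move: (n_gt0 t) => n0.
  apply: lerD.
    by rewrite gerBl mulr_ge0 ?divr_ge0 ?(ltW n0)// (le_trans (h_ge0 t)).
  rewrite ler_wpM2r ?invr_ge0 ?exprn_ge0 ?(ltW n0)//.
  by rewrite ler_wpM2l// mulr_ge0 ?ltW.
move=> t; rewrite geq_max => /andP[t1t LCt] _; move: (n_gt0 t) (descentE t).
have : L * C1 <= t%:R + 2.
  apply: (le_trans (ltW (truncnS_gt _))).
  by apply: (@le_trans _ _ t%:R); rewrite ?ler_nat//; lra.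
set n := t%:R + 2 => nLC n0 hS; apply: (le_trans hS).
apply: (@le_trans _ _ (h t - 2 * (n - L * C1) / n ^+ 2 * g t)).
  have -> : h t - 2 * (n - L * C1) / n ^+ 2 * g t =
      h t - 2 / n * g t + 2 * L * (C1 * g t) / n ^+ 2 by field; rewrite gt_eqF.
  rewrite lerD2l ler_wpM2r ?invr_ge0 ?exprn_ge0 ?(ltW n0)//.
  by rewrite ler_wpM2l ?near// mulr_ge0 ?ltW.
have -> : (1 - 2 / n + 2 * L * C1 / n ^+ 2) * h t =
    h t - 2 * (n - L * C1) / n ^+ 2 * h t by field; rewrite gt_eqF.
rewrite lerD2l lerN2 ler_wpM2l// divr_ge0 ?exprn_ge0 ?(ltW n0)//.
by rewrite mulr_ge0// subr_ge0.
Qed.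

End descent.

(** * One Frank-Wolfe step and lower bounds on the gap *)

Section frank_wolfe_step.
Context {R : realType} {d : nat}.
Variables (C : set 'rV[R]_d) (f : 'rV[R]_d -> R) (S : 'rV[R]_d -> 'rV[R]_d).
Variable L : R.
Hypotheses (C_convex : convex_set C)
  (f_convex : convex_function (setT : set 'rV[R]_d) f)
  (f_diff : forall x, differentiable f x)
  (L_gt0 : 0 < L) (f_smooth : smooth_on C L f) (S_lmo : lmo_selector C S).

Lemma fw_step_le x c : C x -> 0 <= c <= 1 ->
  f (x + c *: (S (gradient f x) - x)) <=
    f x - c * fw_gap f S x + L / 2 * c ^+ 2 * fw_dist f S x ^+ 2.
Proof.
move=> Cx c01; have [CS _] := S_lmo (gradient f x).
have := f_smooth Cx (convex_set_segment C_convex Cx CS c01).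
rewrite (addrC x (c *: _)) addrK dotvZr enormZ exprMn real_normK ?num_real// enormB.
by rewrite -opprB dotvNr mulrN mulrA.
Qed.

Lemma fw_gap_ge x y : C y -> dotv (gradient f x) (x - y) <= fw_gap f S x.
Proof.
move=> Cy; rewrite /fw_gap !dotvBr lerD2l lerN2.
by have [_] := S_lmo (gradient f x); exact.
Qed.

Lemma sub_le_dotv_gradient x y : dotv (gradient f x) (x - y) >= f x - f y.
Proof.
have := convex_gradient_le y f_convex (f_diff x).
by rewrite -(opprB x y) dotvNr; lra.
Qed.

(** The clamped ratio minimizes the convex quadratic -c g + (e/2) c^2 over [0, 1]; it is used with e
    = L d^2. *)
Lemma short_step_le (g a c e : R) : 0 <= g -> 0 < e -> 0 <= c <= 1 ->
  a = Num.min (g / e) 1 ->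
  - a * g + e / 2 * a ^+ 2 <= - c * g + e / 2 * c ^+ 2.
Proof.
move=> g0 e0 /andP[c0 c1] ->; have [ge1|ge1] := leP (g / e) 1.
  have ge : g = g / e * e by rewrite divfK ?gt_eqF.
  move: (g / e) ge => k -> {ge1 g0}; rewrite -subr_ge0.
  rewrite (_ : _ - _ = e / 2 * (k - c) ^+ 2); last by field.
  by rewrite mulr_ge0 ?sqr_ge0// divr_ge0// ltW.
have eg : e < g by move: ge1; rewrite ltr_pdivlMr// mul1r.
rewrite -subr_ge0 (_ : _ - _ = (1 - c) * ((g - e) + e / 2 * (1 - c))); last by field.
have c1' : 0 <= 1 - c by lra.
by apply: mulr_ge0 => //; have := mulr_ge0 (ltW e0) c1'; lra.
Qed.

(* The short step and exact line search both decrease [f] at least as much as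
   any fixed step bounded through smoothness, in particular the open-loop one. *)
Lemma fw_open_loop_descent x gamma :
  frank_wolfe C f S x gamma ->
  short_step f S L x gamma \/ exact_line_search f S x gamma \/
    open_loop gamma ->
  forall t, C (x t) /\ f (x t.+1) <= f (x t)
    - 2 / (t%:R + 2) * fw_gap f S (x t)
    + L / 2 * (2 / (t%:R + 2)) ^+ 2 * fw_dist f S (x t) ^+ 2.
Proof.
move=> [Cx0 xS] rule t.
have Cx k : C (x k).
  elim: k => // k IH; have [g01 ->] := xS k.
  by apply: convex_set_segment => //; have [] := S_lmo (gradient f (x k)).
split=> //; have [g01 ->] := xS t.
set c : R := 2 / (t%:R + 2).
have c01 : 0 <= c <= 1.
  have t2 : 0 < t%:R + 2 :> R by rewrite ltr_wpDl.
  by rewrite divr_ge0 ?(ltW t2)//= ler_pdivrMr// mul1r lerDr.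
case: rule => [ss|[ls|ol]].
- apply: (le_trans (fw_step_le (Cx t) g01)).
  (* At zero distance the gap vanishes too, so the unconstrained step is harmless. *)
  have [d0|d0] := eqVneq (fw_dist f S (x t)) 0.
    suff -> : fw_gap f S (x t) = 0 by rewrite d0 expr0n/= !mulr0.
    move/eqP: d0; rewrite enorm_eq0 => /eqP d0.
    by rewrite /fw_gap d0 dotv0r.
  have Ld : 0 < L * fw_dist f S (x t) ^+ 2 by rewrite mulr_gt0// exprn_even_gt0.
  have g0 : 0 <= fw_gap f S (x t).
    by apply: le_trans (fw_gap_ge _ (Cx t)); rewrite subrr dotv0r.
  have := short_step_le g0 Ld c01 (ss t d0); lra.
- have [_ /(_ c)] := ls t; rewrite /= in_itv/= c01 => /(_ isT) lsc.
  exact: le_trans lsc (fw_step_le (Cx t) c01).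
- by rewrite ol; exact: fw_step_le.
Qed.

(** Convexity and Cauchy-Schwarz bound the error by p |x - z| for every minimizer [z]; dividing by p
    > 0 allows passing to the infimum. *)
Lemma sub_min_le_dist x y : argmin C f y -> C x ->
  f x - f y <= enorm (direction_proj C (gradient f x)) * dist x (argmin C f).
Proof.
move=> My Cx; set p := enorm _.
have le_p z : argmin C f z -> f x - f y <= p * enorm (x - z).
  move=> Mz; have [Cz zmin] := Mz; have [Cy ymin] := My.
  apply: le_trans (_ : f x - f z <= _); first by rewrite lerD2l lerN2 zmin.
  apply: (le_trans (sub_le_dotv_gradient x z)).
  by rewrite -(dotv_direction_proj _ Cx Cz) dotv_le_enorm.
have [p0|p0] := eqVneq p 0; first by have := le_p _ My; rewrite p0 !mul0r.
have {}p0 : 0 < p by rewrite lt_neqAle eq_sym p0 enorm_ge0.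
rewrite -ler_pdivrMl//; apply: dist_ge => [|z Mz]; first by exists y.
by rewrite ler_pdivrMl// le_p.
Qed.

(* Between a first-order flat minimizer and [x], [f] lies below the quadratic
   [f y + L / 2 * enorm (z - y) ^+ 2], which makes the convexity bound strict. *)
Lemma flat_gap_ge x y : argmin C f y -> C x -> f y < f x ->
  dotv (gradient f y) (x - y) = 0 ->
  f x - f y + (f x - f y) ^+ 2 / (2 * L * enorm (x - y) ^+ 2) <=
    dotv (gradient f x) (x - y).
Proof.
move=> [Cy ymin] Cx fyx flat; set T := enorm (x - y) ^+ 2.
have smooth c : 0 <= c <= 1 -> f (y + c *: (x - y)) <= f y + L / 2 * c ^+ 2 * T.
  move=> c01; have := f_smooth Cy (convex_set_segment C_convex Cy Cx c01).
  rewrite (addrC y (c *: _)) addrK dotvZr flat mulr0 addr0 enormZ exprMn.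
  by rewrite real_normK ?num_real// mulrA.
have hP := sub_le_dotv_gradient x y; set P := dotv _ _ in hP *.
set h := f x - f y in hP *; have h0 : 0 < h by rewrite subr_gt0.
have hT : h <= L / 2 * T.
  have := smooth 1; rewrite ler01 lexx scale1r addrC subrK expr1n /h => /(_ isT).
  lra.
have T0 : 0 < T.
  have : 0 < L / 2 * T by exact: lt_le_trans hT.
  by rewrite pmulr_rgt0// divr_gt0.
(* The tangent at [x] and the quadratic bound at y + c (x - y) give P >= h + c h - (L/2) c^2 T; this
   [c] maximizes the right-hand side. *)
pose c := h / (L * T).
have c01 : 0 <= c <= 1.
  apply/andP; split; first exact: divr_ge0 (ltW h0) (ltW (mulr_gt0 L_gt0 T0)).
  rewrite /c ler_pdivrMr; last exact: mulr_gt0.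
  rewrite mul1r.
  by have := mulr_gt0 L_gt0 T0; lra.
have := convex_gradient_le (y + c *: (x - y)) f_convex (f_diff x).
have -> : y + c *: (x - y) - x = (1 - c) *: - (x - y).
  by rewrite scalerN scalerBl scale1r opprB addrAC addrC opprB.
rewrite dotvZr dotvNr -/P => /le_trans/(_ (smooth c c01)).
have [c0 c1] := andP c01.
have cP : c * h <= c * P by rewrite ler_wpM2l.
have -> : h ^+ 2 / (2 * L * T) = c * h - L / 2 * c ^+ 2 * T.
  by rewrite /c; field; rewrite !gt_eqF.
rewrite /h; move: cP; rewrite /h; lra.
Qed.

End frank_wolfe_step.

(** * The rate for the iterates *)

Theorem theorem4p2 (R : realType) (d : nat) (C : set 'rV[R]_d)
    (f : 'rV[R]_d -> R) (S : 'rV[R]_d -> 'rV[R]_d) (L A q B rho r : R)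
    (x : nat -> 'rV[R]_d) (gamma : nat -> R)
    (C_nonempty : C !=set0) (C_compact : compact C) (C_convex : convex_set C)
    (f_convex : convex_function (setT : set 'rV[R]_d) f)
    (f_C1 : continuously_differentiable f)
    (L_gt0 : 0 < L) (f_smooth : smooth_on C L f)
    (S_lmo : lmo_selector C S)
    (A_gt0 : 0 < A) (q_ge2 : 2 <= q)
    (C_sharp : local_dual_sharpness C S (argmin C f) A q)
    (r_ge2 : 2 <= r) (B_gt0 : 0 < B) (rho_gt0 : 0 < rho)
    (f_bound : local_holder_error_bound C f r B rho)
    (x_fw : frank_wolfe C f S x gamma)
    (gamma_rule : short_step f S L x gamma \/ exact_line_search f S x gamma \/
                  open_loop gamma) :
  exists (t0 : nat) (K : R), 0 < K /\
    forall t : nat, (t0 <= t)%N ->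
      f (x t) - minval C f <=
        K / (t - t0 + 1)%N%:R `^ (r * q / (r * q - 2)).
Proof.
have [f_diff gradf_cont] := f_C1.
have f_cont : continuous f by move=> z; exact: differentiable_continuous.
have [y0 My0] : argmin C f !=set0.
  have [|y Cy ymin] := EVT_min_rV C_nonempty C_compact (f := f).
    exact: continuous_subspaceT.
  exists y; split; first by rewrite inE in Cy.
  by move=> z /mem_set; exact: ymin.
have [Cy0 y0min] := My0; rewrite (minvalE My0).
pose h t := f (x t) - f y0.
pose g t := fw_gap f S (x t).
pose D t := fw_dist f S (x t) ^+ 2.
set b := r * q / (r * q - 2).
have rq4 : 4 <= r * q.
  by rewrite (_ : 4 = 2 * 2 :> R) ?ler_pM//; ring.
have b12 : 1 <= b <= 2.
  by rewrite /b ler_pdivlMr ?ler_pdivrMr; [apply/andP; split|..]; lra.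
(* As t - t0 + 1 <= t + 2, a bound by powers of t + 2 is stronger. *)
suff [t0 [K [K0 hK]]] : exists (t0 : nat) (K : R), 0 < K /\
    forall t, (t0 <= t)%N -> h t <= K / (t%:R + 2) `^ b.
  exists t0, K; split=> // t /hK /le_trans; apply; have /andP[b1 b2] := b12.
  rewrite ler_wpM2l ?(ltW K0)// lef_pV2 ?posrE ?powR_gt0 ?ltr_wpDl ?ltr0n ?addn1//.
  apply: ge0_ler_powR; rewrite ?nnegrE ?addr_ge0//; first lra.
  by rewrite -natrD ler_nat addn2 ltnS ltnW// ltnS leq_subr.
have x_desc := fw_open_loop_descent C_convex L_gt0 f_smooth S_lmo x_fw gamma_rule.
have Cx t : C (x t) by have [] := x_desc t.
have h_ge0 t : 0 <= h t by rewrite subr_ge0 y0min.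
have h_le_g t : h t <= g t.
  exact: le_trans (sub_le_dotv_gradient f_convex f_diff _ _) (fw_gap_ge _ S_lmo _ Cy0).
have desc t : h t.+1 <= h t - 2 / (t%:R + 2) * g t
    + L / 2 * (2 / (t%:R + 2)) ^+ 2 * D t.
  by have [_] := x_desc t; rewrite /h /g /D; lra.
have [E0 [E0_ge0 D_le]] : exists E0, 0 <= E0 /\ forall t, D t <= E0.
  have [|z Cz zmax] := EVT_max_rV C_nonempty C_compact (f := @enorm R d).
    by apply: continuous_subspaceT; exact: enorm_continuous.
  exists ((enorm z + enorm z) ^+ 2); split=> [|t]; first exact: sqr_ge0.
  rewrite ler_sqr ?nnegrE ?addr_ge0 ?enorm_ge0//.
  rewrite /fw_dist; set s := S _; apply: (le_trans (enorm_triangle _ _)).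
  have enormN : enorm (- s) = enorm s by rewrite -sub0r enormB subr0.
  rewrite enormN lerD ?zmax// inE//.
  by have [] := S_lmo (gradient f (x t)).
have M0 : argmin C f !=set0 by exists y0.
have fM z : C z -> f z - f y0 = 0 -> argmin C f z.
  by move=> Cz /subr0_eq fz; split=> // w Cw; rewrite fz y0min.
(* Since the errors tend to 0, a continuous function positive on the minimizers is eventually
   bounded below along the iterates. *)
have localize (u : 'rV[R]_d -> R) : continuous u ->
    (forall z, argmin C f z -> 0 < u z) ->
    exists2 e, 0 < e & exists t1, forall t, (t1 <= t)%N -> e <= u (x t).
  move=> cu uM.
  have hc : continuous (fun z => f z - f y0).
    by move=> z; apply: continuousB; [exact: f_cont|exact: cst_continuous].
  have [z Cz|z Cz /(fM _ Cz)|e e0 eu] := @compact_localize _ _ _ _ u C_nonempty C_compact hc cu.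
  - by rewrite subr_ge0 y0min.
  - exact: uM.
  have [t1 ht1] := descent_cvg0 L_gt0 h_le_g D_le desc e0 E0_ge0.
  by exists e => //; exists t1 => t t1t; apply: eu => //; exact: ht1.
have near_M e : 0 < e ->
    exists t1, forall t, (t1 <= t)%N -> dist (x t) (argmin C f) < e.
  move=> e0.
  have du : continuous (fun z : 'rV[R]_d => e - dist z (argmin C f)).
    move=> z; apply: (@continuousB _ _ _ (cst e) (fun z => dist z (argmin C f))).
      exact: cst_continuous.
    exact: dist_continuous.
  have [z Mz|e1 e10 [t1 ht1]] := localize _ du.
    rewrite subr_gt0; apply: le_lt_trans e0; apply: le_trans (dist_le z Mz) _.
      by rewrite subrr enorm0.
  by exists t1 => t /ht1; rewrite lerBrDr -lerBrDl => /le_lt_trans; apply; lra.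
have [rho' rho'0 sharp] := C_sharp.
have [ta far] := near_M _ rho_gt0; have [tb fbr] := near_M _ rho'0.
have dist_pow t : (ta <= t)%N -> dist (x t) (argmin C f) `^ r <= B * h t.
  by move=> /far near; rewrite /h -(minvalE My0); exact: f_bound.
have grad_sharp t : (tb <= t)%N ->
    A * enorm (direction_proj C (gradient f (x t))) *
      fw_dist f S (x t) `^ q <= g t.
  by move=> /fbr near; exact: sharp.
have dist_ge0 z : 0 <= dist z (argmin C f).
  by apply: dist_ge => // y _; exact: enorm_ge0.
have D_gap t : (maxn ta tb <= t)%N -> 0 < h t ->
    D t <= (B `^ r^-1 / A) `^ (2 / q) * g t / h t `^ b^-1.
  rewrite geq_max => /andP[tat tbt] ht.
  have -> : b^-1 = 1 - 2 / (r * q) by rewrite /b; field; apply/andP; split; lra.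
  apply: (@sqr_dist_le_gap _ _ _ _ (dist (x t) (argmin C f))
    (enorm (direction_proj C (gradient f (x t))))) => //.
  - exact: enorm_ge0.
  - exact: enorm_ge0.
  - exact: sub_min_le_dist.
  - exact: dist_pow.
  - exact: grad_sharp.
have C1_gt0 : 0 < (B `^ r^-1 / A) `^ (2 / q).
  by rewrite powR_gt0// divr_gt0// powR_gt0.
have [rq_gt4|rq_le4] := ltP 4 (r * q).
  apply: (descent_powR_rate L_gt0 h_ge0 h_le_g D_le desc b12 _ C1_gt0 E0_ge0
    (kappa := 1) (t1 := maxn ta tb)) => [|t t1t ht].
    by rewrite mulr1 /b ltr_pdivrMr; lra.
  by rewrite mul1r; split => //; exact: D_gap.
have [r2 q2] : r = 2 /\ q = 2 by split; nra.
have b2 : b = 2 by rewrite /b r2 q2; field.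
have [flat|] := pselect (forall z w, C z -> C w -> dotv (gradient f y0) (z - w) = 0).
  (* The excess of [kappa] over 1 is the gain h^2 / (2 L T) of [flat_gap_ge], divided by [h], with T
     replaced by its upper bound 2 B h. *)
  apply: (descent_powR_rate L_gt0 h_ge0 h_le_g D_le desc b12 _ C1_gt0 E0_ge0
    (kappa := 1 + (4 * L * B)^-1) (t1 := maxn ta tb)) => [|t t1t ht].
    by rewrite b2 mulrDr mulr1 ltrDl mulr_gt0// invr_gt0 !mulr_gt0.
  split; last exact: D_gap.
  have tat : (ta <= t)%N by apply: leq_trans t1t; rewrite leq_maxl.
  have Bh0 : 0 < 2 * (B * h t) by rewrite !mulr_gt0.
  (* The factor 2 gives strict room above dist^2 <= B h, so a nearby minimizer exists without the
     infimum being attained. *)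
  have [||y My xy] := @dist_lt _ _ (argmin C f) (x t) (Num.sqrt (2 * (B * h t))) => //.
    rewrite -ltr_sqr ?nnegrE ?sqrtr_ge0// sqr_sqrtr ?ltW//.
    have := dist_pow t tat; rewrite r2 (powR_mulrn 2)// => /le_lt_trans; apply.
    by rewrite mulr_natl mulr2n ltrDl mulr_gt0.
  have [Cy ymin] := My.
  have fy : f y = f y0 by apply/eqP; rewrite eq_le ymin// y0min.
  have flat_y : dotv (gradient f y) (x t - y) = 0.
    by rewrite (argmin_gradient_eq C_convex f_convex f_diff My My0) flat.
  have T0 : 0 < enorm (x t - y) ^+ 2.
    rewrite exprn_even_gt0//= enorm_eq0 subr_eq0; apply/eqP => xty.
    by move: ht; rewrite /h xty fy subrr ltxx.
  have TB : enorm (x t - y) ^+ 2 <= 2 * (B * h t).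
    by rewrite -(sqr_sqrtr (ltW Bh0)) ler_sqr ?nnegrE ?enorm_ge0 ?sqrtr_ge0// ltW.
  have fyx : f y < f (x t) by rewrite fy -subr_gt0.
  apply: le_trans (fw_gap_ge _ S_lmo _ Cy).
  apply: le_trans (flat_gap_ge C_convex f_convex f_diff L_gt0 f_smooth My (Cx t) fyx flat_y).
  rewrite fy -/(h t) mulrDl mul1r lerD2l.
  have -> : (4 * L * B)^-1 * h t = h t ^+ 2 / (2 * L * (2 * (B * h t))).
    by field; rewrite !gt_eqF.
  have L2 : 0 < 2 * L by rewrite mulr_gt0.
  rewrite ler_wpM2l ?sqr_ge0// lef_pV2 ?posrE ?(mulr_gt0 L2)//.
  by rewrite ler_wpM2l// ltW.
move=> /existsNP[z /existsNP[w /not_implyP[Cz /not_implyP[Cw zw]]]].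
have {z w Cz Cw zw} [z [w [Cz Cw zw]]] :
    exists z w, [/\ C z, C w & 0 < dotv (gradient f y0) (z - w)].
  have [zw0|zw0|/esym//] := ltgtP 0 (dotv (gradient f y0) (z - w)).
    by exists z, w.
  by exists w, z; split => //; rewrite -opprB dotvNr oppr_gt0.
(* The slope along z - w is positive at every minimizer, so it eventually stays above some e > 0.
   Cauchy-Schwarz then gives p >= e / |z - w|, and sharpness with q = 2 gives D <= |z - w| g / (A
   e). *)
have cu : continuous (fun y => dotv (gradient f y) (z - w)).
  by apply: (dotv_continuous gradf_cont); exact: cst_continuous.
have [y My|e e0 [tc hc]] := localize _ cu.
  by rewrite (argmin_gradient_eq C_convex f_convex f_diff My My0).
have zw_gt0 : 0 < enorm (z - w).
  rewrite lt_neqAle enorm_ge0 andbT eq_sym enorm_eq0; apply/eqP => zw0.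
  by move: zw; rewrite zw0 dotv0r ltxx.
rewrite b2.
apply: (descent_sqr_rate L_gt0 h_ge0 h_le_g D_le desc
  (C1 := enorm (z - w) / (A * e)) (t1 := maxn tb tc)) => // [|t].
  by rewrite divr_ge0 ?mulr_ge0 ?ltW.
rewrite geq_max => /andP[tbt tct].
have := grad_sharp t tbt; rewrite q2 (powR_mulrn 2) ?enorm_ge0// -/(D t).
set p := enorm _ => sharp_t.
have ep : e <= p * enorm (z - w).
  by rewrite (le_trans (hc t tct))// -(dotv_direction_proj _ Cz Cw) dotv_le_enorm.
have D0 : 0 <= D t by exact: sqr_ge0.
rewrite mulrAC ler_pdivlMr ?mulr_gt0//.
apply: (@le_trans _ _ (A * (p * enorm (z - w)) * D t)).
  by rewrite mulrC ler_wpM2r// ler_wpM2l// ltW.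
rewrite (_ : A * _ * _ = enorm (z - w) * (A * p * D t)); last ring.
by rewrite ler_wpM2l ?enorm_ge0.
Qed.
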